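(* A three-dimensional subspace $\mathfrak{q}$ of the Lie algebra $\mathfrak{g}=\mathfrak{g}_{3,6}\oplus\mathfrak{g}_1$ generates $\mathfrak{g}$ if and only if $\mathfrak{q}\ne\mathfrak{g}_{3,6}$ and the projection of $\mathfrak{q}$ to $\mathfrak{g}_{3,6}$ along $\mathfrak{g}_1$ is not a two-dimensional subalgebra of the Lie algebra $\mathfrak{g}_{3,6}$. There exist five equivalence classes of such subspaces.
   Context: $\mathfrak{g}_{3,6}$ is the three-dimensional real Lie algebra with basis $E_1,E_2,E_3$ and $[E_2,E_3]=E_1$, $[E_3,E_1]=E_2$, $[E_1,E_2]=-E_3$ (isomorphic to $\mathfrak{sl}(2,\mathbb{R})$); $\mathfrak{g}_1=\langle E_4\rangle$ is the one-dimensional Lie algebra. A subspace generates $\mathfrak{g}$ if the smallest Lie subalgebra containing it is $\mathfrak{g}$. Two subspaces are equivalent if one is the image of the other under an automorphism of the Lie algebra $\mathfrak{g}$. *)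

(* Defs.v *)
From HB Require Import structures.
From mathcomp Require Import all_boot all_order all_algebra.
From mathcomp Require Import ring.
From mathcomp Require Import all_classical.

Set Implicit Arguments.
Unset Strict Implicit.
Unset Printing Implicit Defensive.

Import GRing.Theory.
Local Open Scope ring_scope.
Local Open Scope classical_set_scope.

HB.mixin Record Vector_isLieAlgebra (K : fieldType) L of Vector K L := {
  lie : L -> L -> L;
  lie_linearl : forall y : L, linear (lie^~ y);
  lie_linearr : forall x : L, linear (lie x);
  liexx : forall x : L, lie x x = 0;
  lie_jacobi : forall x y z : L,
    lie x (lie y z) + lie y (lie z x) + lie z (lie x y) = 0
}.

#[short(type="lieAlgType")]
HB.structure Definition LieAlgebra (K : fieldType) :=
  {L of Vector_isLieAlgebra K L & Vector K L}.

Section LieAlgebraTheory.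
Variables (K : fieldType) (L : lieAlgType K).
Implicit Types U V : {vspace L}.

Definition is_subalgebra U := forall x y : L, x \in U -> y \in U -> lie x y \in U.

Definition is_generated_subalgebra U V :=
  [/\ is_subalgebra V, (U <= V)%VS &
      forall W : {vspace L}, is_subalgebra W -> (U <= W)%VS -> (V <= W)%VS].

Definition generates U := is_generated_subalgebra U fullv.

Definition lie_automorphism (f : 'End(L)) :=
  bijective f /\ forall x y : L, f (lie x y) = lie (f x) (f y).

Definition lie_equiv U V :=
  exists2 f : 'End(L), lie_automorphism f & V = (f @: U)%VS.

Definition lie_equiv_classes (S : set {vspace L}) : set (set {vspace L}) :=
  [set [set V | S V /\ lie_equiv U V] | U in S].

End LieAlgebraTheory.

Section DirectSum.
Variables (K : fieldType) (L1 L2 : lieAlgType K).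

Definition prod_lie (x y : L1 * L2) : L1 * L2 := (lie x.1 y.1, lie x.2 y.2).

Fact prod_lie_linearl y : linear (prod_lie^~ y).
Proof. by move=> a u v; rewrite /prod_lie /= !lie_linearl. Qed.

Fact prod_lie_linearr x : linear (prod_lie x).
Proof. by move=> a u v; rewrite /prod_lie /= !lie_linearr. Qed.

Fact prod_liexx x : prod_lie x x = 0.
Proof. by rewrite /prod_lie !liexx. Qed.

Fact prod_lie_jacobi x y z :
  prod_lie x (prod_lie y z) + prod_lie y (prod_lie z x)
    + prod_lie z (prod_lie x y) = 0.
Proof. by congr pair; exact: lie_jacobi. Qed.

HB.instance Definition _ := Vector_isLieAlgebra.Build K (L1 * L2)%type
  prod_lie_linearl prod_lie_linearr prod_liexx prod_lie_jacobi.

Definition inj1 (x : L1) : L1 * L2 := (x, 0).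

Fact inj1_is_linear : linear inj1.
Proof. by move=> a u v; congr pair; rewrite /= scaler0 addr0. Qed.

HB.instance Definition _ :=
  GRing.isLinear.Build K L1 (L1 * L2)%type *:%R inj1 inj1_is_linear.

Definition summand1 : {vspace L1 * L2} := limg (linfun inj1).

Definition proj1 : 'Hom((L1 * L2)%type, L1) := linfun fst.

Fact mem_summand1 (u : L1 * L2) : (u \in summand1) = (u.2 == 0).
Proof.
apply/memv_imgP/eqP => [[x _ ->]|u20]; first by rewrite lfunE.
by exists u.1; rewrite ?memvf// lfunE /= /inj1 -u20 -surjective_pairing.
Qed.

Fact proj1E (u : L1 * L2) : proj1 u = u.1.
Proof. by rewrite lfunE. Qed.

End DirectSum.

Section G36.
Variable K : fieldType.

Definition g36 : Type := 'rV[K]_3.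
HB.instance Definition _ := Vector.on g36.

Definition E1 : g36 := delta_mx 0 (inord 0).
Definition E2 : g36 := delta_mx 0 (inord 1).
Definition E3 : g36 := delta_mx 0 (inord 2).

(* Coordinate of x on E1, E2, E3 for i = 0, 1, 2 respectively. *)
Definition g36_coord (i : nat) (x : g36) : K := (x : 'rV[K]_3) 0 (inord i).

(* The bilinear alternating map determined by
   [E2, E3] = E1, [E3, E1] = E2 and [E1, E2] = - E3. *)
Definition g36_lie (x y : g36) : g36 :=
  let c := g36_coord in
    (c 1 x * c 2 y - c 2 x * c 1 y) *: E1
  + (c 2 x * c 0 y - c 0 x * c 2 y) *: E2
  + (c 0 x * c 1 y - c 1 x * c 0 y) *: (- E3).

Fact g36_coord_eq (x y : g36) :
  (forall i, (i < 3)%N -> g36_coord i x = g36_coord i y) -> x = y.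
Proof.
move=> h; apply/rowP => i; have := h i (ltn_ord i).
by rewrite /g36_coord inord_val.
Qed.

Fact g36_coord_lie i (x y : g36) : (i < 3)%N ->
  g36_coord i (g36_lie x y) =
  nth 0 [:: g36_coord 1 x * g36_coord 2 y - g36_coord 2 x * g36_coord 1 y;
            g36_coord 2 x * g36_coord 0 y - g36_coord 0 x * g36_coord 2 y;
            g36_coord 1 x * g36_coord 0 y - g36_coord 0 x * g36_coord 1 y] i.
Proof.
move: i => [|[|[|//]]] _; rewrite /g36_lie {1}/g36_coord !mxE;
  rewrite -!val_eqE /= !inordK //=; ring.
Qed.

Fact g36_coordZD i a (x y : g36) :
  g36_coord i (a *: x + y) = a * g36_coord i x + g36_coord i y.
Proof. by rewrite /g36_coord !mxE. Qed.

Fact g36_coordD i (x y : g36) :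
  g36_coord i (x + y) = g36_coord i x + g36_coord i y.
Proof. by rewrite /g36_coord mxE. Qed.

Fact g36_coord0 i : g36_coord i 0 = 0.
Proof. by rewrite /g36_coord mxE. Qed.

Fact g36_lie_linearl y : linear (g36_lie^~ y).
Proof.
move=> a u v; apply: g36_coord_eq => i hi.
rewrite [RHS]g36_coordZD !g36_coord_lie //.
move: i hi => [|[|[|//]]] _ /=; rewrite !g36_coordZD; ring.
Qed.

Fact g36_lie_linearr x : linear (g36_lie x).
Proof.
move=> a u v; apply: g36_coord_eq => i hi.
rewrite [RHS]g36_coordZD !g36_coord_lie //.
move: i hi => [|[|[|//]]] _ /=; rewrite !g36_coordZD; ring.
Qed.

Fact g36_liexx x : g36_lie x x = 0.
Proof.
apply: g36_coord_eq => i hi; rewrite g36_coord0 g36_coord_lie //.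
move: i hi => [|[|[|//]]] _ /=; ring.
Qed.

Fact g36_lie_jacobi x y z :
  g36_lie x (g36_lie y z) + g36_lie y (g36_lie z x)
    + g36_lie z (g36_lie x y) = 0.
Proof.
apply: g36_coord_eq => i hi; rewrite g36_coord0 2!g36_coordD !g36_coord_lie //.
move: i hi => [|[|[|//]]] _ /=; ring.
Qed.

HB.instance Definition _ := Vector_isLieAlgebra.Build K g36
  g36_lie_linearl g36_lie_linearr g36_liexx g36_lie_jacobi.

Fact g36_lieE2E3 : lie E2 E3 = E1.
Proof.
apply: g36_coord_eq => i hi; rewrite [lie _ _]/(g36_lie _ _) g36_coord_lie //.
by move: i hi => [|[|[|//]]] _ /=;
  rewrite /g36_coord !mxE -!val_eqE /= !inordK //=; ring.
Qed.

Fact g36_lieE3E1 : lie E3 E1 = E2.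
Proof.
apply: g36_coord_eq => i hi; rewrite [lie _ _]/(g36_lie _ _) g36_coord_lie //.
by move: i hi => [|[|[|//]]] _ /=;
  rewrite /g36_coord !mxE -!val_eqE /= !inordK //=; ring.
Qed.

Fact g36_lieE1E2 : lie E1 E2 = - E3.
Proof.
apply: g36_coord_eq => i hi; rewrite [lie _ _]/(g36_lie _ _) g36_coord_lie //.
by move: i hi => [|[|[|//]]] _ /=;
  rewrite /g36_coord !mxE -!val_eqE /= !inordK //=; ring.
Qed.

End G36.

Section G1.
Variable K : fieldType.

Definition g1 : Type := K^o.
HB.instance Definition _ := Vector.on g1.

Definition g1_lie (x y : g1) : g1 := 0.

Fact g1_lie_linearl y : linear (g1_lie^~ y).
Proof. by move=> a u v; rewrite /g1_lie scaler0 addr0. Qed.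

Fact g1_lie_linearr x : linear (g1_lie x).
Proof. by move=> a u v; rewrite /g1_lie scaler0 addr0. Qed.

Fact g1_liexx x : g1_lie x x = 0.
Proof. by []. Qed.

Fact g1_lie_jacobi x y z :
  g1_lie x (g1_lie y z) + g1_lie y (g1_lie z x) + g1_lie z (g1_lie x y) = 0.
Proof. by rewrite /g1_lie !addr0. Qed.

HB.instance Definition _ := Vector_isLieAlgebra.Build K g1
  g1_lie_linearl g1_lie_linearr g1_liexx g1_lie_jacobi.

End G1.

Definition g36_g1 (K : fieldType) : lieAlgType K := (g36 K * g1 K)%type.

(* Main.v *)
(* The form B = x0 y0 + x1 y1 - x2 y2 is invariant, so every hyperplane of g is
   hyp n t = {(x, s) | B n x + t s = 0} for some (n, t) <> 0, unique up to
   scaling.  If t <> 0, brackets of elements of hyp n t fill g36, and g1 is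
   reached as soon as n <> 0; if t = 0, the projection is the B-orthogonal of n,
   a subalgebra exactly when n is isotropic.  A frame, i.e. a triple of g36 with
   the same brackets as E1, E2, E3, gives an automorphism of g36; frames adapted
   to n bring n to a multiple of E1, E3 or E1 + E3 according to the sign of
   B n n, and scaling g1 reduces t to 0 or 1.  The five normal forms are told
   apart by whether they meet the center, whether they contain a nonzero bracket
   z with (ad z)^3 = 0, and whether their brackets are closed under lie. *)
From HB Require Import structures.
Require Import Defs.
From mathcomp Require Import all_boot all_order all_algebra.
From mathcomp Require Import ring lra.
From mathcomp Require Import all_classical reals.

Set Implicit Arguments.
Unset Strict Implicit.
Unset Printing Implicit Defensive.

Import Order.TTheory GRing.Theory Num.Theory.

Local Open Scope ring_scope.
Local Open Scope classical_set_scope.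
Local Open Scope card_scope.

(** * Hyperplanes as kernels of linear forms *)

Lemma hyperplane_functional (K : fieldType) (V : vectType K) (q : {vspace V}) :
  (\dim q).+1 = \dim {:V} ->
  exists2 phi : {linear V -> K^o}, (exists u, phi u != 0) &
    forall u, (u \in q) = (phi u == 0).
Proof.
move=> hq.
have dC : \dim (q^C) = 1%N by rewrite dimv_compl -hq subSnn.
have capq : (q^C :&: q = 0)%VS by rewrite capvC capv_compl.
have capq' : (q :&: q^C = 0)%VS by rewrite capv_compl.
pose i0 : 'I_(\dim q^C) := cast_ord (esym dC) ord0.
have all0 (i : 'I_(\dim q^C)) : i = i0.
  by apply: val_inj; case: i => i /=; rewrite dC; case: i.
(* [P] projects onto the complement of [q] along [q]. The complement is a line, so its single
   coordinate is the required form. *)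
pose P := daddv_pi q^C q.
pose g u : K^o := coord (vbasis q^C) i0 (P u).
have glin : linear g by move=> a u v; rewrite /g !linearP.
pose G := GRing.isLinear.Build K V K^o *:%R g glin.
pose phi : {linear V -> K^o} := HB.pack g G.
have decomp u : daddv_pi q q^C u + P u = u.
  by rewrite daddv_pi_add // addv_complf memvf.
have memq u : (u \in q) = (phi u == 0).
  apply/idP/eqP => [uq|u0].
    suff Pu : P u = 0 by rewrite /phi /= /g Pu linear0.
    by apply: (addrI u); rewrite addr0 -{1}(daddv_pi_id capq' uq) decomp.
  have Pu : P u = 0.
    rewrite (coord_vbasis (memv_pi q^C q u)) big1 // => i _.
    by rewrite (all0 i) -/P [coord _ _ _]u0 scale0r.
  by rewrite -(decomp u) Pu addr0 memv_pi.
exists phi => //.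
have /subvPn [u _ nq] : ~~ (fullv <= q)%VS.
  by apply/negP => /dimvS; rewrite -hq ltnn.
by exists u; rewrite -memq.
Qed.

Lemma dim_lker_functional (K : fieldType) (V : vectType K)
    (f : 'Hom(V, K^o)) u :
  f u != 0 -> (\dim (lker f)).+1 = \dim {:V}.
Proof.
move=> fu; rewrite -(limg_ker_dim f fullv) capfv.
suff -> : \dim (limg f) = 1%N by rewrite addn1.
apply/eqP; rewrite eqn_leq; apply/andP; split.
  by rewrite (leq_trans (dimvS (subvf _))) // dimvf.
rewrite lt0n dimv_eq0; apply: contraNneq fu => f0.
by rewrite -memv0 -f0 memv_img ?memvf.
Qed.

(** * Invariants of equivalence of subspaces *)

Section Equivalence.
Variables (K : fieldType) (L : lieAlgType K).
Implicit Types U V W : {vspace L}.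

Lemma lie_equiv_refl U : lie_equiv U U.
Proof.
exists \1%VF; last by rewrite lim1g.
by split=> [|x y]; rewrite ?id_lfunE //; exists id => x; rewrite id_lfunE.
Qed.

Lemma lie_equiv_sym U V : lie_equiv U V -> lie_equiv V U.
Proof.
move=> [f [/bij_inj/lker0P kf fM] ->].
have fK := lker0_lfunK kf; have fVK := lker0_lfunVK kf.
exists (f^-1)%VF; last by rewrite -limg_comp lker0_compVf // lim1g.
split=> [|x y]; first by exists f.
by apply: (can_inj fK); rewrite fM !fVK.
Qed.

Lemma lie_equiv_trans U V W : lie_equiv U V -> lie_equiv V W -> lie_equiv U W.
Proof.
move=> [f [fb fM] ->] [h [hb hM] ->].
exists (h \o f)%VF; last by rewrite limg_comp.
split=> [|x y]; last by rewrite !comp_lfunE fM hM.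
apply: (@eq_bij _ _ (h \o f)) => [|x]; first exact: bij_comp.
by rewrite comp_lfunE.
Qed.

(** Sending [i] to the class of [r i] is onto the classes because every member of [S] is equivalent
    to some [r i], and injective because each class contains its own representative. *)
Lemma lie_equiv_classes_card (S : set {vspace L}) (k : nat)
    (r : nat -> {vspace L}) :
  (forall i, (i < k)%N -> S (r i)) ->
  (forall U, S U -> exists2 i, (i < k)%N & lie_equiv (r i) U) ->
  (forall i j, (i < k)%N -> (j < k)%N -> lie_equiv (r i) (r j) -> i = j) ->
  lie_equiv_classes S #= `I_k.
Proof.
move=> Sr rS rinj; pose F U := [set V | S V /\ lie_equiv U V].
have -> : lie_equiv_classes S = (F \o r) @` `I_k.
  apply/seteqP; split=> [_ [U SU <-]|_ [i /= ik <-]]; last first.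
    by exists (r i) => //; exact: Sr.
  have [i ik rU] := rS U SU; exists i => //=.
  apply/seteqP; split=> V [SV UV]; split=> //.
    exact: lie_equiv_trans (lie_equiv_sym rU) UV.
  exact: lie_equiv_trans rU UV.
apply: inj_card_eq => i j; rewrite !inE /= => ik jk eF.
apply: rinj => //; apply: lie_equiv_sym.
suff [] : F (r j) (r i) by [].
by rewrite -eF; split; [exact: Sr | exact: lie_equiv_refl].
Qed.

(** The center of g is g1, so on [hyp n t] this property detects t = 0. *)
Definition meets_center U :=
  exists z : L, [/\ z != 0, z \in U & forall x, lie z x = 0].

(** In g a bracket lies in the summand g36, where the vanishing of the cube of ad z amounts to B z z
    = 0 by [lie_cube]. The property thus asks for isotropic brackets without mentioning [B]. *)
Definition has_nilpotent_bracket U := exists x y : L,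
  let z := lie x y in
  [/\ z != 0, z \in U & forall w, lie z (lie z (lie z w)) = 0].

(** This separates the isotropic normal E1 + E3, whose orthogonal is a subalgebra of g36, from the
    normal E1. *)
Definition brackets_closed U := forall x y x' y' : L,
  lie x y \in U -> lie x' y' \in U -> lie (lie x y) (lie x' y') \in U.

Lemma lie_equiv_meets_center U V :
  lie_equiv U V -> meets_center U -> meets_center V.
Proof.
move=> [f [fb fM] ->] [z [z0 zU zC]]; have [f' fK f'K] := fb.
exists (f z); split; first by rewrite -(linear0 f) (inj_eq (bij_inj fb)).
  exact: memv_img.
by move=> x; rewrite -[x]f'K -fM zC linear0.
Qed.

Lemma lie_equiv_nilpotent_bracket U V :
  lie_equiv U V -> has_nilpotent_bracket U -> has_nilpotent_bracket V.
Proof.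
move=> [f [fb fM] ->] [x [y [z0 zU zN]]]; have [f' fK f'K] := fb.
exists (f x), (f y); rewrite /= -fM; split.
- by rewrite -(linear0 f) (inj_eq (bij_inj fb)).
- exact: memv_img.
- by move=> w; rewrite -[w]f'K -!fM zN linear0.
Qed.

Lemma lie_equiv_brackets_closed U V :
  lie_equiv U V -> brackets_closed U -> brackets_closed V.
Proof.
move=> [f [fb fM] ->] cU x y x' y'; have [f' fK f'K] := fb.
rewrite -[x]f'K -[y]f'K -[x']f'K -[y']f'K -!fM.
move=> /memv_imgP [a aU /(bij_inj fb) ea] /memv_imgP [b bU /(bij_inj fb) eb].
by apply: memv_img; apply: cU; rewrite ?ea ?eb.
Qed.

End Equivalence.

(** * Hyperplanes of g36 + g1 *)

Section Coordinates.
Variable K : fieldType.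
Local Notation g3 := (g36 K).
Local Notation x_ := (@g36_coord K).
Implicit Types (x y : g3) (a b c : K).

Definition vec a b c : g3 := a *: E1 K + b *: E2 K + c *: E3 K.

Lemma coordZ i c x : x_ i (c *: x) = c * x_ i x.
Proof. by rewrite -[c *: x]addr0 g36_coordZD g36_coord0 addr0. Qed.

Lemma coordN i x : x_ i (- x) = - x_ i x.
Proof. by rewrite -scaleN1r coordZ mulN1r. Qed.

Lemma coord_lie0 x y :
  x_ 0 (lie x y) = x_ 1 x * x_ 2 y - x_ 2 x * x_ 1 y.
Proof. by rewrite [lie _ _]/(g36_lie _ _) g36_coord_lie. Qed.

Lemma coord_lie1 x y :
  x_ 1 (lie x y) = x_ 2 x * x_ 0 y - x_ 0 x * x_ 2 y.
Proof. by rewrite [lie _ _]/(g36_lie _ _) g36_coord_lie. Qed.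

Lemma coord_lie2 x y :
  x_ 2 (lie x y) = x_ 1 x * x_ 0 y - x_ 0 x * x_ 1 y.
Proof. by rewrite [lie _ _]/(g36_lie _ _) g36_coord_lie. Qed.

Lemma coord_E1 i : (i < 3)%N -> x_ i (E1 K) = (i == 0)%:R.
Proof.
by move: i => [|[|[|//]]] _; rewrite /g36_coord mxE -!val_eqE /= !inordK.
Qed.

Lemma coord_E2 i : (i < 3)%N -> x_ i (E2 K) = (i == 1)%:R.
Proof.
by move: i => [|[|[|//]]] _; rewrite /g36_coord mxE -!val_eqE /= !inordK.
Qed.

Lemma coord_E3 i : (i < 3)%N -> x_ i (E3 K) = (i == 2)%:R.
Proof.
by move: i => [|[|[|//]]] _; rewrite /g36_coord mxE -!val_eqE /= !inordK.
Qed.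

Lemma coord_vec i a b c : (i < 3)%N -> x_ i (vec a b c) = nth 0 [:: a; b; c] i.
Proof.
move=> hi; rewrite /vec !g36_coordD !coordZ coord_E1 // coord_E2 // coord_E3 //.
by case: i hi => [|[|[|//]]] _ /=; ring.
Qed.

Definition coordE := (g36_coordD, coordN, coordZ, coord_lie0, coord_lie1,
  coord_lie2, coord_vec, coord_E1, coord_E2, coord_E3, g36_coord0).

Lemma coord_eq x y :
  x_ 0 x = x_ 0 y -> x_ 1 x = x_ 1 y -> x_ 2 x = x_ 2 y -> x = y.
Proof. by move=> *; apply: g36_coord_eq => [[|[|[|]]]]. Qed.

Lemma vecE x : vec (x_ 0 x) (x_ 1 x) (x_ 2 x) = x.
Proof. by apply: coord_eq; rewrite coord_vec. Qed.

End Coordinates.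

Ltac coord_ring := apply: coord_eq; rewrite !coordE //=; ring.

(** * The invariant form and its identities *)

Section Algebra.
Variable K : fieldType.
Local Notation g3 := (g36 K).
Local Notation g := (g36_g1 K).
Local Notation x_ := (@g36_coord K).
Implicit Types (x y z n w : g3) (c t : K).

(* A multiple of the Killing form. *)
Definition B x y : K := x_ 0 x * x_ 0 y + x_ 1 x * x_ 1 y - x_ 2 x * x_ 2 y.

Fact B_is_linear x : linear (B x : g3 -> K^o).
Proof. by move=> c y z; rewrite /B !coordE /GRing.scale /=; ring. Qed.

HB.instance Definition _ x :=
  GRing.isLinear.Build K g3 K^o *:%R (B x) (B_is_linear x).

Lemma B_sym x y : B x y = B y x.
Proof. by rewrite /B; ring. Qed.

Lemma B_lie x y z : B (lie x y) z = B x (lie y z).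
Proof. by rewrite /B !coordE; ring. Qed.

Lemma BZl c x y : B (c *: x) y = c * B x y.
Proof. by rewrite /B !coordE; ring. Qed.

Lemma B_lincomb a b c x y z w :
  B w (a *: x + b *: y + c *: z) = a * B w x + b * B w y + c * B w z.
Proof. by rewrite /B !coordE; ring. Qed.

(** E1, E2 and -E3 are themselves brackets, so a vector orthogonal to all brackets has only zero
    coordinates. *)
Lemma B_nondegenerate_lie x : x != 0 -> exists y z, B x (lie y z) != 0.
Proof.
move=> x0; have [h1|] := eqVneq (B x (E1 K)) 0; last first.
  by rewrite -g36_lieE2E3; eauto.
have [h2|] := eqVneq (B x (E2 K)) 0; last by rewrite -g36_lieE3E1; eauto.
exists (E1 K), (E2 K); rewrite g36_lieE1E2.
apply: contraNneq x0; move: h1 h2; rewrite /B !coordE //= => h1 h2 h3.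
by apply/eqP; apply: coord_eq; rewrite g36_coord0;
  [rewrite -h1|rewrite -h2|rewrite -h3]; ring.
Qed.

Lemma B_nondegenerate x : x != 0 -> exists y, B x y != 0.
Proof. by move=> /B_nondegenerate_lie [y [z h]]; exists (lie y z). Qed.

(* Cramer's rule, as B n (lie x y) is the determinant of n, x, y. *)
Lemma lie_B_decomp n x y w :
  B n (lie x y) *: w = B w n *: lie x y + B w x *: lie y n + B w y *: lie n x.
Proof. rewrite /B; coord_ring. Qed.

(** For [w] equal to [n] the right-hand side of [lie_B_decomp] vanishes, so B n (lie x y)
    annihilates the nonzero vector [n]. *)
Lemma lie_normal n x y :
  n != 0 -> B n n = 0 -> B n x = 0 -> B n y = 0 -> B n (lie x y) = 0.
Proof.
move=> n0 nn nx ny; have := lie_B_decomp n x y n.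
rewrite nn nx ny !scale0r !addr0 => /eqP.
by rewrite scaler_eq0 (negPf n0) orbF => /eqP.
Qed.

(** Both [lie n x] and [lie n y] are orthogonal to [n], so this recovers [n] from a bracket inside
    its own orthogonal. *)
Lemma lie_lie_normal n x y : lie (lie n x) (lie n y) = - B n (lie x y) *: n.
Proof. rewrite /B; coord_ring. Qed.

(** * Hyperplanes given by a normal vector and a scalar *)

Definition hyp_form n t (u : g) : K^o := B n u.1 + t * u.2.

Fact hyp_form_is_linear n t : linear (hyp_form n t).
Proof.
move=> c u v; rewrite /hyp_form /= !linearP.
(* The second components live in [g1 K]; their operations must be displayed as those of [K] before
   [ring] can see them. *)
rewrite -[c *: u.2 + v.2]/(c * (u.2 : K) + (v.2 : K)) /GRing.scale /=.
rewrite -[LHS]/((c * B n u.1 + B n v.1) + t * (c * u.2 + v.2) : K).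
rewrite -[RHS]/(c * (B n u.1 + t * u.2) + (B n v.1 + t * v.2) : K).
by ring.
Qed.

HB.instance Definition _ n t :=
  GRing.isLinear.Build K g K^o *:%R (hyp_form n t) (hyp_form_is_linear n t).

Definition hyp n t : {vspace g} := lker (linfun (hyp_form n t)).

Lemma mem_hyp n t (u : g) : (u \in hyp n t) = (B n u.1 + t * u.2 == 0).
Proof. by rewrite memv_ker lfunE. Qed.

Lemma dim_g : \dim {:g} = 4%N.
Proof. by rewrite dimvf. Qed.

Lemma dim_g3 : \dim {:g3} = 3%N.
Proof. by rewrite dimvf. Qed.

Lemma dim_hyp n t : (n != 0) || (t != 0) -> \dim (hyp n t) = 3%N.
Proof.
move=> nt; apply: succn_inj; rewrite -dim_g.
have [n0|/B_nondegenerate [x nx]] := eqVneq n 0; last first.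
  by apply: (@dim_lker_functional _ _ _ (x, 0));
    rewrite lfunE /= /hyp_form mulr0 addr0.
apply: (@dim_lker_functional _ _ _ ((0, 1 : K) : g)).
by rewrite lfunE /= /hyp_form linear0 add0r mulr1; rewrite n0 eqxx in nt.
Qed.

Lemma pairD x y (r s : K) :
  ((x, r) : g) + ((y, s) : g) = ((x + y, r + s) : g).
Proof. by []. Qed.
Lemma pairZ c y (s : K) :
  c *: ((y, s) : g) = ((c *: y, c * s) : g).
Proof. by []. Qed.
Lemma pairB x y (r s : K) :
  ((x, r) : g) - ((y, s) : g) = ((x - y, r - s) : g).
Proof. by []. Qed.

Lemma pairE (x : g3) (s : K) :
  ((x, s) : g) = inj1 (g1 K) x + s *: ((0, 1 : K) : g).
Proof. by rewrite pairZ pairD scaler0 addr0 add0r mulr1. Qed.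
Lemma inj1_vec (x : g3) : inj1 (g1 K) x = x_ 0 x *: inj1 (g1 K) (E1 K) + 
   x_ 1 x *: inj1 (g1 K) (E2 K) + x_ 2 x *: inj1 (g1 K) (E3 K).
Proof. by rewrite -{1}[x]vecE /vec !linearD !linearZ_LR. Qed.

Lemma hypP (q : {vspace g}) : \dim q = 3%N ->
  exists n t, (n != 0) || (t != 0) /\ q = hyp n t.
Proof.
move=> dq; have [|phi [u u0] phiP] := @hyperplane_functional K g q.
  by rewrite dq dim_g.
pose e x := inj1 (g1 K) x.
pose a : K := phi (e (E1 K)); pose b : K := phi (e (E2 K)).
pose c : K := phi (e (E3 K)); pose t : K := phi ((0, 1 : K) : g).
(* The minus sign compensates for B E3 E3 = -1. *)
pose n := vec a b (- c).
have phiE (v : g) : phi v = B n v.1 + t * v.2.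
  case: v => x s.
  have -> : phi (x, s) = (x_ 0 x * a + x_ 1 x * b + x_ 2 x * c + s * t : K).
    by rewrite pairE inj1_vec linearD linearZ_LR 2!linearD 3!linearZ_LR.
  by rewrite /B /n !coordE //=; ring.
exists n, t; split; last by apply/vspaceP => v; rewrite phiP phiE mem_hyp.
rewrite -negb_and; apply: contraNN u0 => /andP [/eqP n0 /eqP t0].
by rewrite phiE n0 t0 mul0r addr0 B_sym linear0.
Qed.

Lemma hyp0 t : t != 0 -> hyp 0 t = summand1 (g36 K) (g1 K).
Proof.
move=> t0; apply/vspaceP => u.
by rewrite mem_hyp mem_summand1 B_sym linear0 add0r mulf_eq0 (negPf t0).
Qed.

Lemma hypZ c n t : c != 0 -> hyp (c *: n) (c * t) = hyp n t.
Proof.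
move=> c0; apply/vspaceP => u.
by rewrite !mem_hyp BZl -mulrA -mulrDr mulf_eq0 (negPf c0).
Qed.

(** * Which hyperplanes generate *)

Lemma summand1_subalgebra : is_subalgebra (summand1 (g36 K) (g1 K)).
Proof. by move=> x y _ _; rewrite mem_summand1. Qed.

Lemma proper_subalgebra_not_generates (L : lieAlgType K) (q W : {vspace L}) u :
  is_subalgebra W -> (q <= W)%VS -> u \notin W -> ~ generates q.
Proof.
by move=> sW qW /negP uW [_ _ /(_ W sW qW) /subvP /(_ u (memvf u))].
Qed.

(** The preimage of the plane under the projection is a subalgebra, since the projection respects
    brackets; it contains [q] and is proper. *)
Lemma proj_subalgebra_not_generates (q : {vspace g}) :
  \dim (proj1 (g36 K) (g1 K) @: q) = 2%N ->
  is_subalgebra (proj1 (g36 K) (g1 K) @: q)%VS -> ~ generates q.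
Proof.
set p := proj1 _ _; set V := (p @: q)%VS => dV sV.
have /subvPn [x _ xV] : ~~ (fullv <= V)%VS.
  by apply/negP => /dimvS; rewrite dim_g3 dV.
apply: (@proper_subalgebra_not_generates _ _ (p @^-1: V)%VS (x, 0)).
- move=> y z; rewrite -!memv_preim !proj1E; exact: sV.
- by apply/subvP => y yq; rewrite -memv_preim memv_img.
- by rewrite -memv_preim proj1E.
Qed.

Lemma summand1_not_generates : ~ generates (summand1 (g36 K) (g1 K)).
Proof.
apply: (@proper_subalgebra_not_generates _ _ _ ((0, 1 : K) : g)
  summand1_subalgebra (subvv _)).
by rewrite mem_summand1 oner_eq0.
Qed.

Lemma proj_hyp0 n :
  (proj1 (g36 K) (g1 K) @: hyp n 0)%VS = lker (linfun (B n : g3 -> K^o)).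
Proof.
apply/vspaceP => x; rewrite memv_ker lfunE /=.
apply/memv_imgP/eqP => [[u]|nx].
  by rewrite mem_hyp mul0r addr0 => /eqP nu ->; rewrite proj1E.
by exists (x, 0); rewrite ?proj1E // mem_hyp mul0r addr0 nx.
Qed.

Lemma proj_hyp_isotropic n : n != 0 -> B n n = 0 ->
  \dim (proj1 (g36 K) (g1 K) @: hyp n 0) = 2%N /\
  is_subalgebra (proj1 (g36 K) (g1 K) @: hyp n 0)%VS.
Proof.
move=> n0 nn; rewrite proj_hyp0 //; split.
  have [x nx] := B_nondegenerate n0; apply: succn_inj; rewrite -dim_g3.
  by apply: (@dim_lker_functional _ _ _ x); rewrite lfunE.
move=> x y; rewrite !memv_ker !lfunE /= => /eqP nx /eqP ny.
by apply/eqP; exact: lie_normal.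
Qed.

Lemma subalgebra_full (W : {vspace g}) :
  (forall x, ((x, 0) : g) \in W) ->
  (exists2 s : K, s != 0 & ((0, s) : g) \in W) ->
  (fullv <= W)%VS.
Proof.
move=> W1 [s s0 Ws]; apply/subvP => -[x r] _.
have -> : ((x, r) : g) = ((x, 0) : g) + ((r : K) / s) *: ((0, s) : g).
  by rewrite pairZ pairD scaler0 addr0 add0r divfK.
by rewrite memvD ?memvZ.
Qed.

Lemma in_g36 (W : {vspace g}) :
  ((E1 K, 0) : g) \in W -> ((E2 K, 0) : g) \in W -> ((E3 K, 0) : g) \in W ->
  forall x, ((x, 0) : g) \in W.
Proof.
by move=> W1 W2 W3 x; rewrite -[(x, 0)]/(inj1 _ x) inj1_vec !memvD ?memvZ.
Qed.

(** For nonzero [t] the hyperplane is the graph over g36 of x -> - B n x / t. Brackets of lifts lose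
    their g1 component and hence yield all of g36; subtracting (x, 0) from a lift with B n x nonzero
    then yields g1. *)
Lemma hyp_generates_transversal n t : n != 0 -> t != 0 -> generates (hyp n t).
Proof.
move=> n0 t0; split=> [x y _ _||W sW /subvP qW]; rewrite ?memvf ?subvf //.
have lift x : ((x, - (B n x / t)) : g) \in W.
  by apply: qW; rewrite mem_hyp /= mulrN mulrCA divff // mulr1 subrr.
have brak x y : ((lie x y, 0) : g) \in W by exact: sW (lift x) (lift y).
have W1 : forall x, ((x, 0) : g) \in W.
  apply: in_g36.
  - by rewrite -g36_lieE2E3.
  - by rewrite -g36_lieE3E1.
  - by rewrite -memvN -scaleN1r pairZ scaleN1r mulr0 -g36_lieE1E2.
apply: subalgebra_full => //.
have [x nx] := B_nondegenerate n0.
exists (- (B n x / t)); first by rewrite oppr_eq0 mulf_neq0 ?invr_eq0.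
have -> : ((0, - (B n x / t)) : g) = (x, - (B n x / t)) - (x, 0).
  by rewrite pairB subrr subr0.
by rewrite memvB.
Qed.

(** The hyperplane is the orthogonal of [n] plus g1. Only the direction of [n] is missing, because
    g36 splits into the line of [n] and its orthogonal. *)
Lemma hyp_generates_vertical n : B n n != 0 -> generates (hyp n 0).
Proof.
move=> nn; split=> [x y _ _||W sW /subvP qW]; rewrite ?memvf ?subvf //.
have perp x s : B n x = 0 -> ((x, s) : g) \in W.
  by move=> nx; apply: qW; rewrite mem_hyp /= nx mul0r addr0.
have Wn : ((n, 0) : g) \in W.
  have n0 : n != 0 by apply: contraNneq nn => ->; rewrite linear0.
  have [y [z nyz]] := B_nondegenerate_lie n0.
  have nlie w : B n (lie n w) = 0 by rewrite -B_lie liexx B_sym linear0.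
  (* By [lie_lie_normal] this bracket is a multiple of [n], with a nonzero factor by the choice of
     [y] and [z]. *)
  have := sW _ _ (perp _ 0 (nlie y)) (perp _ 0 (nlie z)).
  rewrite [lie _ _](_ : _ = - B n (lie y z) *: ((n, 0) : g)).
    by rewrite rpredZeq oppr_eq0 (negPf nyz).
  by rewrite pairZ mulr0 -lie_lie_normal.
apply: subalgebra_full => [x|]; last first.
  by exists 1; rewrite ?oner_eq0 // perp // linear0.
rewrite -(subrK ((B n x / B n n) *: ((n, 0) : g)) ((x, 0) : g)).
rewrite memvD ?memvZ //.
rewrite pairZ pairB; apply: perp.
rewrite linearB linearZ /= /GRing.scale /=.
by rewrite divfK // subrr.
Qed.

Lemma generates_hypE n t : (n != 0) || (t != 0) ->
  generates (hyp n t) <-> n != 0 /\ ~~ ((t == 0) && (B n n == 0)).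
Proof.
move=> nt; split=> [gen|[n0]].
  have [n0|n0] := eqVneq n 0.
    rewrite n0 eqxx in nt; case: summand1_not_generates.
    by rewrite -(@hyp0 t) -?n0.
  split=> //; apply/negP => /andP [/eqP t0 /eqP nn].
  have [dV sV] := proj_hyp_isotropic n0 nn.
  by rewrite t0 in gen; exact: proj_subalgebra_not_generates gen.
have [->|t0 _] := eqVneq t 0; first exact: hyp_generates_vertical.
exact: hyp_generates_transversal.
Qed.

Lemma generatesP (q : {vspace g}) : \dim q = 3%N ->
  generates q <->
  q <> summand1 (g36 K) (g1 K) /\
  ~ (\dim (proj1 (g36 K) (g1 K) @: q) = 2%N /\
     is_subalgebra (proj1 (g36 K) (g1 K) @: q)%VS).
Proof.
move=> dq; split=> [gen|].
  split=> [qE|[d2 sub]]; first by apply: summand1_not_generates; rewrite -qE.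
  exact: proj_subalgebra_not_generates gen.
have [n [t [nt ->]]] := hypP dq; case=> q1 q2; apply/generates_hypE => //.
have n0 : n != 0.
  apply: contra_notN q1 => /eqP n0; rewrite n0 eqxx in nt.
  by rewrite n0 hyp0.
split=> //; apply: contra_notN q2 => /andP [/eqP -> /eqP nn].
exact: proj_hyp_isotropic.
Qed.

(** The Lorentzian counterpart of the double cross product expansion, with the sign opposite to the
    Euclidean one. *)
Lemma lie_lie x y z : lie x (lie y z) = B x y *: z - B x z *: y.
Proof. rewrite /B; coord_ring. Qed.

(** * Frames and automorphisms *)

(** The normalization B x x = 1 rules out the zero triple, which satisfies the three bracket
    relations. *)
Definition is_frame x y z :=
  [/\ lie y z = x, lie z x = y, lie x y = - z & B x x = 1].

Lemma frame_of_orthonormal x y :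
  B x x = 1 -> B y y = 1 -> B x y = 0 -> is_frame x y (- lie x y).
Proof.
move=> xx yy xy; have yx : B y x = 0 by rewrite B_sym.
split=> //; last by rewrite opprK.
- have -> : lie y (- lie x y) = - lie y (lie x y) by coord_ring.
  by rewrite lie_lie yx yy scale0r sub0r opprK scale1r.
- have -> : lie (- lie x y) x = lie x (lie x y) by coord_ring.
  by rewrite lie_lie xx xy scale0r subr0 scale1r.
Qed.

(** Invariance of [B] reduces each mixed product to a bracket of a vector with itself, and carries B
    x x = 1 over to [y] and then, with a sign, to [z]. *)
Lemma frame_gram x y z : is_frame x y z ->
  [/\ B x y = 0, B x z = 0, B y z = 0, B y y = 1 & B z z = -1].
Proof.
move=> [yz zx xy xx].
have yy : B y y = 1 by rewrite -{2}zx -B_lie yz.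
split=> //.
- by rewrite -yz B_sym -B_lie liexx B_sym linear0.
- by rewrite -yz B_lie liexx linear0.
- by rewrite -zx B_sym -B_lie liexx B_sym linear0.
- by rewrite -yy -{1}zx B_lie xy linearN opprK.
Qed.

Section Frame.
Variables (x y z : g3).
Hypothesis xyz : is_frame x y z.

Definition frame_map (w : g3) : g3 :=
  x_ 0 w *: x + x_ 1 w *: y + x_ 2 w *: z.

Lemma frame_map_isometry v w : B (frame_map v) (frame_map w) = B v w.
Proof.
have [xy xz yz yy zz] := frame_gram xyz; have [_ _ _ xx] := xyz.
rewrite B_lincomb !(B_sym (frame_map v)) !B_lincomb.
rewrite (B_sym y x) (B_sym z x) (B_sym z y) xx xy xz yy yz zz /B; ring.
Qed.

Lemma frame_map_lie v w : frame_map (lie v w) = lie (frame_map v) (frame_map w).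
Proof.
have [yz zx xy _] := xyz.
(* Once [x], [y], [z] are replaced by brackets, the claim is bilinear expansion, valid for any three
   vectors. *)
transitivity (x_ 0 (lie v w) *: lie y z + x_ 1 (lie v w) *: lie z x
  - x_ 2 (lie v w) *: lie x y).
  by rewrite yz zx xy scalerN opprK.
rewrite /frame_map; coord_ring.
Qed.

Definition frame_ext (c : K) (u : g) : g := (frame_map u.1, c * u.2).

Fact frame_ext_is_linear c : linear (frame_ext c).
Proof.
move=> a [v r] [w s]; rewrite /frame_ext pairZ pairD pairZ pairD /=.
by congr (_, _); [rewrite /frame_map; coord_ring | ring].
Qed.

HB.instance Definition _ c :=
  GRing.isLinear.Build K g g *:%R (frame_ext c) (frame_ext_is_linear c).

(** As g1 is abelian, it may be scaled freely. The kernel is zero because [frame_map] is an isometry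
    of a nondegenerate form and [c] is nonzero. *)
Lemma frame_ext_automorphism c :
  c != 0 -> lie_automorphism (linfun (frame_ext c)).
Proof.
move=> c0; split=> [|u v]; last first.
  rewrite !lfunE /=; congr (_, _); first exact: frame_map_lie.
  exact: mulr0.
have k0 : lker (linfun (frame_ext c)) == 0%VS.
  rewrite -subv0; apply/subvP => -[v s].
  rewrite memv_ker lfunE memv0 /= /frame_ext /= -!pair_eqE /= mulf_eq0.
  rewrite (negPf c0) /= => /andP [/eqP v0 ->]; rewrite andbT.
  apply/eqP; apply: contraTeq isT => /B_nondegenerate [w].
  by rewrite -frame_map_isometry v0 B_sym linear0 eqxx.
exists (linfun (frame_ext c))^-1%VF; first exact: lker0_lfunK.
exact: lker0_lfunVK.
Qed.

(** Pulling the defining form back along [frame_ext c] leaves the part in [B] intact, by isometry,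
    and multiplies the scalar by [c]. *)
Lemma lie_equiv_frame n t c : c != 0 ->
  lie_equiv (hyp n (t * c)) (hyp (frame_map n) t).
Proof.
move=> c0; have aut := frame_ext_automorphism c0.
exists (linfun (frame_ext c)) => //; have [[f' fK f'K] _] := aut.
apply/vspaceP => u; rewrite -[u]f'K; set v := f' u.
have -> : (linfun (frame_ext c) v \in (linfun (frame_ext c) @: hyp n (t * c))%VS)
        = (v \in hyp n (t * c)).
  apply/idP/idP => [/memv_imgP [w wH /(can_inj fK) ->] //|]; exact: memv_img.
by rewrite !mem_hyp lfunE /= frame_map_isometry mulrA.
Qed.

Lemma lie_equiv_frame_scaled m t rho : rho != 0 ->
  lie_equiv (hyp m (t != 0)%:R) (hyp (rho *: frame_map m) t).
Proof.
move=> rho0.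
have -> : hyp (rho *: frame_map m) t = hyp (frame_map m) (rho^-1 * t).
  by rewrite -(@hypZ rho _ (rho^-1 * t)) // mulrA divff // mul1r.
have [->|t0] := eqVneq t 0.
  by have := lie_equiv_frame m 0 (oner_neq0 K); rewrite mul0r mulr0.
(* This scaling of g1 turns the scalar rho^-1 * t into 1. *)
have c0 : (rho^-1 * t)^-1 != 0 by rewrite invr_eq0 mulf_neq0 ?invr_eq0.
by have := lie_equiv_frame m (rho^-1 * t) c0; rewrite divff // -invr_eq0.
Qed.

End Frame.

(** * The invariants evaluated on hyperplanes *)

Lemma centralizer_trivial x : (forall y, lie x y = 0) -> x = 0.
Proof.
move=> xC; apply/eqP; apply: contraT => /B_nondegenerate_lie [y [z]].
by rewrite -B_lie xC B_sym linear0 eqxx.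
Qed.

(** [lie_lie] applies with B z (lie z w) = 0. Hence, for nonzero [z], ad z is nilpotent exactly when
    [z] is isotropic. *)
Lemma lie_cube z w : lie z (lie z (lie z w)) = B z z *: lie z w.
Proof. by rewrite lie_lie -B_lie liexx B_sym linear0 scale0r subr0. Qed.

Lemma hyp_meets_center n t : meets_center (hyp n t) <-> t = 0.
Proof.
split=> [[[x s] [z0 zH zC]]|->]; last first.
  exists ((0, 1 : K) : g); split.
  - by rewrite -pair_eqE /= oner_eq0 andbF.
  - by rewrite mem_hyp linear0 mul0r addr0.
  - by move=> [v r]; congr (_, _); coord_ring.
have x0 : x = 0.
  by apply: centralizer_trivial => y; have [] := zC (y, 0).
move: z0 zH; rewrite x0 mem_hyp linear0 add0r mulf_eq0 -pair_eqE /= eqxx /=.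
by move=> /negPf -> /orP [/eqP|].
Qed.

Lemma hyp_nilpotent_bracket n t : has_nilpotent_bracket (hyp n t) <->
  exists x y, let z := lie x y in [/\ z != 0, B n z = 0 & B z z = 0].
Proof.
split=> [[[x r] [[y s]]]|[x [y [z0 nz zz]]]]; last first.
  exists ((x, 0) : g), ((y, 0) : g); split.
  - by rewrite -pair_eqE /= negb_and z0.
  - by rewrite mem_hyp mulr0 addr0 nz.
  - by move=> w; congr (_, _); rewrite lie_cube zz scale0r.
set z := lie x y => -[z0 zH zN]; exists x, y; rewrite -/z.
have {}z0 : z != 0 by move: z0; rewrite -pair_eqE /= eqxx andbT.
split=> //; first by move: zH; rewrite mem_hyp mulr0 addr0 => /eqP.
apply: contra_neq_eq z0 => zz; apply: centralizer_trivial => w.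
have [/eqP] := zN (w, 0); rewrite lie_cube scaler_eq0 (negPf zz) /=.
by move/eqP.
Qed.

Lemma hyp_brackets_closed n t : brackets_closed (hyp n t) <->
  forall x y x' y', B n (lie x y) = 0 -> B n (lie x' y') = 0 ->
    B n (lie (lie x y) (lie x' y')) = 0.
Proof.
split=> [cl x y x' y' xy x'y'|cl [x r] [y s] [x' r'] [y' s']].
  have := cl (x, 0) (y, 0) (x', 0) (y', 0).
  by rewrite !mem_hyp /= !mulr0 !addr0 xy x'y' eqxx => /(_ isT isT) /eqP.
rewrite !mem_hyp /= !mulr0 !addr0 => /eqP xy /eqP x'y'.
by apply/eqP; exact: cl.
Qed.

End Algebra.

(** * Normal forms over a real closed field *)

Section Classification.
Variable R : rcfType.
Local Notation g3 := (g36 R).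
Local Notation g := (g36_g1 R).
Local Notation x_ := (@g36_coord R).
Implicit Types (n m x y : g3) (t : R).

Lemma spacelike_frame x : B x x = 1 -> exists y z, is_frame x y z.
Proof.
rewrite /B => xx; pose N := x_ 0 x ^+ 2 + x_ 1 x ^+ 2.
have N0 : 0 < N by rewrite /N; nra.
pose r := Num.sqrt N; have r0 : r != 0 by rewrite sqrtr_eq0 -ltNge.
have rr : r ^+ 2 = N by rewrite sqr_sqrtr // ltW.
(* A quarter turn of the first two coordinates is orthogonal to [x] and has square N = 1 + x_2^2,
   positive by B x x = 1. *)
pose y := vec (- x_ 1 x / r) (x_ 0 x / r) 0; exists y, (- lie x y).
apply: frame_of_orthonormal => //; rewrite /B !coord_vec //=.
  transitivity (N / r ^+ 2); first by rewrite /N; field.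
  by rewrite rr divff // gt_eqF.
by field.
Qed.

Lemma timelike_frame z : B z z = -1 -> exists x y, is_frame x y z.
Proof.
move=> zz; move: (zz); rewrite {1}/B => zzE; pose N := x_ 2 z ^+ 2 - x_ 0 z ^+ 2.
have N0 : 0 < N by rewrite /N; nra.
pose r := Num.sqrt N; have r0 : r != 0 by rewrite sqrtr_eq0 -ltNge.
have rr : r ^+ 2 = N by rewrite sqr_sqrtr // ltW.
(* Exchanging the outer coordinates of [z] and dropping the middle one gives a vector orthogonal to
   [z], of square N = 1 + z_1^2. *)
pose x := vec (x_ 2 z / r) 0 (x_ 0 z / r).
have xx : B x x = 1.
  rewrite /B !coord_vec //=.
  transitivity (N / r ^+ 2); first by rewrite /N; field.
  by rewrite rr divff // gt_eqF.
have zx : B z x = 0 by rewrite /B !coord_vec //=; field.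
have xz : B x z = 0 by rewrite B_sym.
exists x, (lie z x); split=> //.
  have -> : lie (lie z x) z = - lie z (lie z x) by coord_ring.
  by rewrite lie_lie zx zz scale0r subr0 scaleN1r opprK.
by rewrite lie_lie xx xz scale0r sub0r scale1r.
Qed.

Lemma hyp_spacelike n t : 0 < B n n ->
  lie_equiv (hyp (E1 R) (t != 0)%:R) (hyp n t).
Proof.
move=> nn; pose r := Num.sqrt (B n n).
have r0 : r != 0 by rewrite sqrtr_eq0 -ltNge.
have [|y [z fr]] := @spacelike_frame (r^-1 *: n).
  by rewrite BZl B_sym BZl mulrA -expr2 exprVn sqr_sqrtr ?mulVf ?gt_eqF // ltW.
have := lie_equiv_frame_scaled fr (E1 R) t r0.
suff -> : r *: frame_map (r^-1 *: n) y z (E1 R) = n by [].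
rewrite /frame_map !coord_E1 //= !scale0r !addr0 scale1r scalerA divff //.
by rewrite scale1r.
Qed.

Lemma hyp_timelike n t : B n n < 0 ->
  lie_equiv (hyp (E3 R) (t != 0)%:R) (hyp n t).
Proof.
move=> nn; pose r := Num.sqrt (- B n n).
have r0 : r != 0 by rewrite sqrtr_eq0 -ltNge oppr_gt0.
have rr : r ^+ 2 = - B n n by rewrite sqr_sqrtr // oppr_ge0 ltW.
have [|x [y fr]] := @timelike_frame (r^-1 *: n).
  rewrite BZl B_sym BZl mulrA -expr2 exprVn rr invrN mulNr mulVf //.
  by rewrite lt_eqF.
have := lie_equiv_frame_scaled fr (E3 R) t r0.
suff -> : r *: frame_map x y (r^-1 *: n) (E3 R) = n by [].
rewrite /frame_map !coord_E3 //= !scale0r !add0r scale1r scalerA divff //.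
by rewrite scale1r.
Qed.

(** With [c] the last coordinate of [n], the first two divided by [c] form a unit vector. Completing
    it to the frame [x], [y], E3, a rotation about E3, gives n = c (x + E3). *)
Lemma hyp_null n t : B n n = 0 -> n != 0 ->
  lie_equiv (hyp (E1 R + E3 R) (t != 0)%:R) (hyp n t).
Proof.
rewrite {1}/B => nn n0; set c := x_ 2 n.
have c0 : c != 0.
  apply: contra_eq_neq nn => c0; rewrite -/c c0 mulr0 subr0.
  apply: contra_neq n0 => /eqP; rewrite -!expr2 paddr_eq0 ?sqr_ge0 // !sqrf_eq0.
  by move=> /andP [/eqP n0 /eqP n1]; apply: coord_eq; rewrite g36_coord0.
have cc : x_ 0 n * x_ 0 n + x_ 1 n * x_ 1 n = c ^+ 2.
  by apply/eqP; rewrite -subr_eq0 expr2 nn.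
pose x := vec (x_ 0 n / c) (x_ 1 n / c) 0.
pose y := vec (- x_ 1 n / c) (x_ 0 n / c) 0.
have one : (x_ 0 n * x_ 0 n + x_ 1 n * x_ 1 n) / c ^+ 2 = 1.
  by rewrite cc divff // expf_neq0.
have xx : B x x = 1 by rewrite -one /B !coord_vec //=; field.
have fr : is_frame x y (E3 R).
  split=> //; apply: coord_eq; rewrite !coordE //=; try ring.
  transitivity (- ((x_ 0 n * x_ 0 n + x_ 1 n * x_ 1 n) / c ^+ 2)).
    by field.
  by rewrite one.
have := lie_equiv_frame_scaled fr (E1 R + E3 R) t c0.
suff -> : c *: frame_map x y (E3 R) (E1 R + E3 R) = n by [].
by apply: coord_eq; rewrite /frame_map /x /y !coordE //=; rewrite -?/c; field.
Qed.

(** The order suits the invariants: t = 0 for indices below 2, and the normal is E3 at odd indices.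
    The sixth pair, E1 + E3 with t = 0, is absent since it does not generate. *)
Definition rep (i : nat) : {vspace g} :=
  nth 0%VS [:: hyp (E1 R) 0; hyp (E3 R) 0; hyp (E1 R) 1; hyp (E3 R) 1;
             hyp (E1 R + E3 R) 1] i.

Lemma E1_neq0 : E1 R != 0.
Proof.
apply/negP => /eqP /(congr1 (x_ 0)); rewrite !coordE //= => /eqP.
by rewrite oner_eq0.
Qed.

Lemma E3_neq0 : E3 R != 0.
Proof.
apply/negP => /eqP /(congr1 (x_ 2)); rewrite !coordE //= => /eqP.
by rewrite oner_eq0.
Qed.

Lemma E13_neq0 : E1 R + E3 R != 0.
Proof.
apply/negP => /eqP /(congr1 (x_ 0)); rewrite !coordE //= => /eqP.
by rewrite addr0 oner_eq0.
Qed.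

Lemma B_E1 : B (E1 R) (E1 R) = 1.
Proof. by rewrite /B !coordE //=; ring. Qed.

Lemma B_E3 : B (E3 R) (E3 R) = -1.
Proof. by rewrite /B !coordE //=; ring. Qed.

Lemma B_E13 : B (E1 R + E3 R) (E1 R + E3 R) = 0.
Proof. by rewrite /B !coordE //=; ring. Qed.

Lemma rep_generates i : (i < 5)%N -> \dim (rep i) = 3%N /\ generates (rep i).
Proof.
have gen n t : n != 0 -> ~~ ((t == 0) && (B n n == 0)) ->
    \dim (hyp n t) = 3%N /\ generates (hyp n t).
  by move=> n0 nt; rewrite dim_hyp ?generates_hypE ?n0.
move: i => [|[|[|[|[|//]]]]] _; apply: gen; rewrite ?E1_neq0
  ?E3_neq0 ?E13_neq0 ?B_E1 ?B_E3 ?oner_eq0 ?oppr_eq0 ?oner_eq0 ?andbF //.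
Qed.

Lemma rep_complete (q : {vspace g}) : \dim q = 3%N -> generates q ->
  exists2 i, (i < 5)%N & lie_equiv (rep i) q.
Proof.
move=> dq; have [n [t [nt ->]]] := hypP dq.
rewrite generates_hypE // => -[n0 tn].
have [t0|t0] := eqVneq t 0.
  have [nn|nn|nn] := ltgtP (B n n) 0.
  - by exists 1%N => //; have := hyp_timelike t nn; rewrite t0 eqxx.
  - by exists 0%N => //; have := hyp_spacelike t nn; rewrite t0 eqxx.
  - by rewrite t0 nn eqxx in tn.
have [nn|nn|nn] := ltgtP (B n n) 0.
- by exists 3%N => //; have := hyp_timelike t nn; rewrite t0.
- by exists 2%N => //; have := hyp_spacelike t nn; rewrite t0.
- by exists 4%N => //; have := hyp_null t nn n0; rewrite t0.
Qed.

Lemma rep_meets_center i : (i < 5)%N -> meets_center (rep i) <-> (i < 2)%N.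
Proof.
have o0 : 1 <> 0 :> R by apply/eqP; exact: oner_neq0.
by move: i => [|[|[|[|[|//]]]]] _; rewrite hyp_meets_center.
Qed.

Lemma rep_nilpotent_bracket i :
  (i < 5)%N -> has_nilpotent_bracket (rep i) <-> ~~ odd i.
Proof.
have n1 t : has_nilpotent_bracket (hyp (E1 R) t).
  (* The vector E2 + E3 is isotropic, orthogonal to E1 and an eigenvector of ad E1. *)
  apply/hyp_nilpotent_bracket; exists (E1 R), (E2 R + E3 R).
  have -> : lie (E1 R) (E2 R + E3 R) = - (E2 R + E3 R) by coord_ring.
  split; try by rewrite /B !coordE //=; ring.
  apply/negP => /eqP /(congr1 (x_ 1)); rewrite !coordE //= addr0 => /eqP.
  by rewrite oppr_eq0 oner_eq0.
have n13 t : has_nilpotent_bracket (hyp (E1 R + E3 R) t).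
  apply/hyp_nilpotent_bracket; exists (E2 R), (E1 R + E3 R).
  have -> : lie (E2 R) (E1 R + E3 R) = E1 R + E3 R by coord_ring.
  split; rewrite ?E13_neq0 ?B_E13 //.
(* The orthogonal of E3 is positive definite, so its only isotropic vector is 0. *)
have n3 t : ~ has_nilpotent_bracket (hyp (E3 R) t).
  move/hyp_nilpotent_bracket => [x [y []]]; move: (lie x y) => z.
  rewrite /B !coordE //= => z0 z3 zz.
  by case/eqP: z0; apply: coord_eq; rewrite g36_coord0; nra.
by move: i => [|[|[|[|[|//]]]]] _; rewrite /rep /=; split=> // /n3.
Qed.

Lemma rep2_brackets_closed : ~ brackets_closed (rep 2).
Proof.
(* The brackets chosen are E2 and E3, both orthogonal to E1, while their own bracket is E1. *)
move/hyp_brackets_closed => /(_ (E3 R) (E1 R) (E2 R) (E1 R)).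
have -> : lie (E2 R) (E1 R) = E3 R by coord_ring.
rewrite g36_lieE3E1 g36_lieE2E3 B_E1 => h.
by case/eqP: (oner_neq0 R); apply: h; rewrite /B !coordE //=; ring.
Qed.

Lemma rep4_brackets_closed : brackets_closed (rep 4).
Proof.
apply/hyp_brackets_closed => x y x' y'.
by apply: lie_normal; [exact: E13_neq0 | exact: B_E13].
Qed.

Lemma rep_inequivalent i j : (i < 5)%N -> (j < 5)%N ->
  lie_equiv (rep i) (rep j) -> i = j.
Proof.
move=> i5 j5 ij; have ji := lie_equiv_sym ij.
have hZ : (i < 2)%N = (j < 2)%N.
  apply/idP/idP => /rep_meets_center h; apply/rep_meets_center => //.
    exact: lie_equiv_meets_center ij (h i5).
  exact: lie_equiv_meets_center ji (h j5).
have hN : ~~ odd i = ~~ odd j.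
  apply/idP/idP => /rep_nilpotent_bracket h; apply/rep_nilpotent_bracket => //.
    exact: lie_equiv_nilpotent_bracket ij (h i5).
  exact: lie_equiv_nilpotent_bracket ji (h j5).
(* The first two invariants separate all distinct indices except 2 and 4. *)
have n24 : ~ lie_equiv (rep 4) (rep 2).
  move=> /lie_equiv_brackets_closed /(_ rep4_brackets_closed).
  exact: rep2_brackets_closed.
by move: i j i5 j5 ij ji hZ hN => [|[|[|[|[|//]]]]] [|[|[|[|[|//]]]]] //.
Qed.

End Classification.

Theorem proposition15 (R : realType) :
  (forall q : {vspace g36_g1 R}, \dim q = 3%N ->
     (generates q <->
      q <> summand1 (g36 R) (g1 R) /\
      ~ (\dim (proj1 (g36 R) (g1 R) @: q) = 2%N /\
         is_subalgebra (proj1 (g36 R) (g1 R) @: q)%VS)))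
  /\
  lie_equiv_classes [set q : {vspace g36_g1 R} | \dim q = 3%N /\ generates q]
    #= `I_5.
Proof.
split=> [q|]; first exact: generatesP.
apply: (@lie_equiv_classes_card _ _ _ _ (@rep R)).
- exact: rep_generates.
- by move=> q [dq gq]; exact: rep_complete.
- exact: rep_inequivalent.
Qed.
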